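(* Let $l,m,n$ be nonnegative integers. Then $$\sum_{k=0}^l(-1)^{m-k}\binom{l}{k}\binom{m-k}{n}\binom{2k}{k-2l+m} =\sum_{k=0}^l\binom lk\binom{2k}n\binom{n-l}{m+n-3k-l}.$$
   Context: For any (real or complex) number $x$ and integer $k$, the binomial coefficient is defined by $\binom xk=\frac1{k!}\prod_{j=0}^{k-1}(x-j)$ if $k>0$, $\binom x0=1$, and $\binom xk=0$ if $k<0$. In particular the upper argument may be negative (e.g. $n-l<0$). *)

(* Defs.v *)
From HB Require Import structures.
From mathcomp Require Import all_boot all_order all_algebra.

Set Implicit Arguments.
Unset Strict Implicit.
Unset Printing Implicit Defensive.

Import Order.TTheory GRing.Theory Num.Theory.
Local Open Scope ring_scope.

(* Generalized binomial coefficient; for k = 0 the empty product gives 1, and *)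
(* Negz covers exactly the integers k < 0.                                    *)
Definition gbinom (F : numFieldType) (x : F) (k : int) : F :=
  match k with
  | Posz n => (n`!)%:R^-1 * \prod_(0 <= j < n) (x - j%:R)
  | Negz _ => 0
  end.

(* Main.v *)
Require Import Defs.
From HB Require Import structures.
From mathcomp Require Import all_boot all_order all_algebra.
From mathcomp Require Import zify ring.

Set Implicit Arguments.
Unset Strict Implicit.
Unset Printing Implicit Defensive.

Import Order.TTheory GRing.Theory Num.Theory.
Local Open Scope ring_scope.

(** Both sides are the coefficient of [x^m y^n] in [(x W)^l], where
    [W = 1 - x + x y^2 + x^2 (1 + y)^2].  The left-hand side comes from
    [W = x z^2 + (1 - x z)^2] with [z = 1 + y], by expanding in powers of [x]
    first; the right-hand side comes from
    [(x + 1) W = 1 + x (x + (x + 1) y)^2], by expanding in powers of [y] first.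
    The division by [(x + 1)^l] that the latter requires is a multiplication by
    the binomial series of exponent [- l], which is where binomials with upper
    argument [n - l] come from. *)

Section GeneralizedBinomial.

Variable F : numFieldType.
Implicit Types (a : F) (k : int).

Let fact_neq0 n : n`!%:R != 0 :> F.
Proof. by rewrite pnatr_eq0 -lt0n fact_gt0. Qed.

Lemma gbinom_nat (m n : nat) : gbinom (m%:R : F) n = 'C(m, n)%:R.
Proof.
suff prodE : \prod_(0 <= j < n) (m%:R - j%:R : F) = (m ^_ n)%:R.
  by rewrite /= prodE -bin_ffact natrM mulrC mulfK.
elim: n => [|n IHn]; first by rewrite big_geq.
rewrite big_nat_recr //= IHn ffactnSr natrM.
have [le_nm|lt_mn] := leqP n m; first by rewrite natrB.
by rewrite ffact_small // !mul0r.
Qed.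

Lemma gbinom_pascal a k : gbinom (a + 1) k = gbinom a k + gbinom a (k - 1).
Proof.
case: k => [[|k]|k]; [by rewrite /= !big_geq ?addr0 | | by rewrite /= addr0].
have -> : k.+1%:Z - 1 = k by lia.
rewrite /= big_nat_recl // big_nat_recr //= subr0.
under eq_bigr => j _ do rewrite -natr1 opprD addrACA subrr addr0.
have k1_neq0 : k%:R + 1 != 0 :> F by rewrite natr1 pnatr_eq0.
by rewrite factS natrM -natr1; field; rewrite fact_neq0.
Qed.

Lemma gbinom_subz a (m e : nat) :
  gbinom a (m%:Z - e%:Z) = if (m < e)%N then 0 else gbinom a (m - e)%N.
Proof.
case: ltnP => [lt_me|/subzn-> //].
by have -> : m%:Z - e%:Z = Negz (e - m).-1 by lia.
Qed.

End GeneralizedBinomial.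

Lemma take_polyM_take (R : nzRingType) N (p q : {poly R}) :
  take_poly N (p * take_poly N q) = take_poly N (p * q).
Proof.
rewrite -[in RHS](poly_take_drop N q) mulrDr mulrA take_polyD.
by rewrite take_polyMXn_0 addr0.
Qed.

Lemma coef_exp_linear (R : comNzRingType) (a b : R) N n :
  ((a%:P + b *: 'X) ^+ N)`_n = a ^+ (N - n) * b ^+ n *+ 'C(N, n).
Proof.
have -> : (a%:P + b *: 'X) ^+ N =
    \poly_(i < N.+1) (a ^+ (N - i) * b ^+ i *+ 'C(N, i)).
  rewrite exprDn poly_def; apply: eq_bigr => i _.
  by rewrite exprZn -polyC_exp mul_polyC scalerA scalerMnl.
by rewrite coef_poly ltnS; case: leqP => // /bin_small->.
Qed.

Section BinomialSeries.

Variable F : numFieldType.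
Implicit Types (a : F) (A B : {poly F}).

Definition binom_series a N : {poly F} := \poly_(i < N) gbinom a i.

Lemma binom_series0 N : binom_series 0 N = take_poly N 1.
Proof.
apply/polyP => i; rewrite coef_poly coef_take_poly coef1.
by rewrite (gbinom_nat F 0) bin0n.
Qed.

Lemma take_poly_XD1M_binom_series a N :
  take_poly N (('X + 1) * binom_series a N) = binom_series (a + 1) N.
Proof.
apply/polyP => i; rewrite coef_take_poly mulrDl mul1r coefD coefXM !coef_poly.
case: ltnP => // lt_iN; rewrite gbinom_pascal addrC.
case: i lt_iN => [|i] lt_iN //; have -> : i.+1%:Z - 1 = i by lia.
by rewrite /= (ltnW lt_iN).
Qed.

Lemma take_poly_XD1nM_binom_series a n N :
  take_poly N (('X + 1) ^+ n * binom_series a N) = binom_series (a + n%:R) N.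
Proof.
elim: n => [|n IHn].
  by rewrite mul1r addr0 take_poly_id // size_poly.
rewrite exprS -mulrA -take_polyM_take IHn take_poly_XD1M_binom_series.
by rewrite -natr1 addrA.
Qed.

Lemma coef_quotient_XD1n A B l n N m :
    A * ('X + 1) ^+ l = B * ('X + 1) ^+ n -> (m < N)%N ->
  A`_m = (B * binom_series (n%:R - l%:R) N)`_m.
Proof.
move=> eqAB lt_mN.
have eq_take : take_poly N A = take_poly N (B * binom_series (n%:R - l%:R) N).
  rewrite addrC -take_poly_XD1nM_binom_series take_polyM_take.
  rewrite mulrA -eqAB -mulrA -take_polyM_take take_poly_XD1nM_binom_series.
  by rewrite addNr binom_series0 take_polyM_take mulr1.
have := congr1 (fun p : {poly F} => p`_m) eq_take.
by rewrite !coef_take_poly lt_mN.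
Qed.

Lemma coefXnM_binom_series a e N m : (m < N)%N ->
  ('X^e * binom_series a N)`_m = gbinom a (m%:Z - e%:Z).
Proof.
move=> lt_mN; rewrite coefXnM gbinom_subz coef_poly.
by rewrite (leq_ltn_trans (leq_subr _ _) lt_mN).
Qed.

End BinomialSeries.

Definition genfun (R : comNzRingType) (x y : R) : R :=
  x * (1 - x + x * y ^+ 2 + x ^+ 2 * (1 + y) ^+ 2).

Lemma rmorph_genfun (R S : comNzRingType) (f : {rmorphism R -> S}) x y :
  f (genfun x y) = genfun (f x) (f y).
Proof.
by rewrite /genfun !(rmorph1, rmorphM, rmorphD, rmorphN, rmorphXn).
Qed.

Lemma genfun_exp (R : comNzRingType) (x y : R) l :
  genfun x y ^+ l = \sum_(k < l.+1)
    (x * (1 + y)) ^+ (2 * (l - k)) * (x ^+ k * (1 - x * (1 + y)) ^+ (2 * k))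
      *+ 'C(l, k).
Proof.
have -> : genfun x y = (x * (1 + y)) ^+ 2 + x * (1 - x * (1 + y)) ^+ 2.
  by rewrite /genfun; ring.
by rewrite exprDn; apply: eq_bigr => k _; rewrite [X in _ * X]exprMn -!exprM.
Qed.

Lemma genfun_exp_mulD1n (R : comNzRingType) (x y : R) l :
  genfun x y ^+ l * (x + 1) ^+ l = \sum_(k < l.+1)
    x ^+ (l + k) * (x + (x + 1) * y) ^+ (2 * k) *+ 'C(l, k).
Proof.
rewrite -exprMn.
have -> : genfun x y * (x + 1) = x + x ^+ 2 * (x + (x + 1) * y) ^+ 2.
  by rewrite /genfun; ring.
rewrite exprDn; apply: eq_bigr => k _.
rewrite exprMn -!exprM mulrA -exprD.
by congr (_ ^+ _ * _ *+ _); have := ltn_ord k; lia.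
Qed.

Lemma coef_genfun_exp_term (R : comNzRingType) (z : R) (l k m : nat) :
    (k <= l)%N ->
  ((z *: 'X) ^+ (2 * (l - k)) * ('X^k * (1 - z *: 'X) ^+ (2 * k)))`_m =
  if (m + k < 2 * l)%N then 0 else (- z) ^+ (m - k) *+ 'C(2 * k, m + k - 2 * l).
Proof.
move=> le_kl; rewrite exprZn -scalerAl coefZ mulrA -exprD coefXnM.
have -> : (m < 2 * (l - k) + k)%N = (m + k < 2 * l)%N by lia.
case: ltnP => [_|le_lm]; first exact: mulr0.
rewrite -scaleNr coef_exp_linear expr1n mul1r mulrnAr.
rewrite exprM -sqrrN -exprM -exprD.
by congr (_ ^+ _ *+ 'C(_, _)); lia.
Qed.

Lemma coef_genfunYX_exp_mulXD1n (R : comNzRingType) l n :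
  (genfun 'Y 'X ^+ l : {poly {poly R}})`_n * ('X + 1) ^+ l =
  (\sum_(k < l.+1) ('C(l, k) * 'C(2 * k, n))%:R *: 'X^(3 * k + l - n))
    * ('X + 1) ^+ n.
Proof.
rewrite -coefMC polyC_exp polyCD genfun_exp_mulD1n coef_sum mulr_suml.
apply: eq_bigr => k _.
rewrite -polyCD mul_polyC coefMn -polyC_exp coefCM coef_exp_linear.
have [lt_kn|le_nk] := ltnP (2 * k) n.
  by rewrite (bin_small lt_kn) muln0 mulr0 mul0rn scale0r mul0r.
rewrite mulrnAr mulrnAC -mulrnA mulrA -exprD scaler_nat mulrnAl.
by congr ('X^_ * _ *+ _); have := ltn_ord k; lia.
Qed.

Section CoefficientFormulas.

Variable F : numFieldType.

Lemma coef_genfunXY_exp l m n :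
  (genfun 'X 'Y ^+ l : {poly {poly F}})`_m`_n = \sum_(k < l.+1)
    (-1) ^ (m%:Z - k%:Z) * gbinom l%:R k * gbinom (m%:R - k%:R) n
      * gbinom (2 * k)%:R (k%:Z - 2 * l%:Z + m%:Z).
Proof.
rewrite genfun_exp !coef_sum; apply: eq_bigr => k _.
have le_kl : (k <= l)%N by rewrite -ltnS.
have -> : 'X * (1 + 'Y) = (1 + 'X : {poly F}) *: 'X.
  by rewrite -mul_polyC polyCD mulrC.
have -> : k%:Z - 2 * l%:Z + m%:Z = (m + k)%N%:Z - (2 * l)%N%:Z by lia.
rewrite !coefMn coef_genfun_exp_term // gbinom_subz.
case: ltnP => [_|le_lm]; first by rewrite coef0 mul0rn mulr0.
have le_km : (k <= m)%N by lia.
rewrite -natrB // subzn // !gbinom_nat -exprnP coefMn -scaleN1r exprZn coefZ.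
rewrite -['X]scale1r coef_exp_linear !expr1n.
by rewrite -!(mulr_natr (_ * _)); ring.
Qed.

Lemma coef_genfunYX_exp l m n :
  (genfun 'Y 'X ^+ l : {poly {poly F}})`_n`_m = \sum_(k < l.+1)
    gbinom l%:R k * gbinom (2 * k)%:R n
      * gbinom (n%:R - l%:R) (m%:Z + n%:Z - 3 * k%:Z - l%:Z).
Proof.
rewrite (coef_quotient_XD1n (coef_genfunYX_exp_mulXD1n F l n) (ltnSn m)).
rewrite mulr_suml coef_sum; apply: eq_bigr => k _.
rewrite -scalerAl coefZ coefXnM_binom_series // !gbinom_nat -natrM.
have [lt_kn|le_nk] := ltnP (2 * k) n.
  by rewrite (bin_small lt_kn) muln0 !mul0r.
by congr (_ * gbinom _ _); have := ltn_ord k; lia.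
Qed.

End CoefficientFormulas.

Theorem theorem1p1 (F : numFieldType) (l m n : nat) :
  \sum_(0 <= k < l.+1)
     (-1) ^ (m%:Z - k%:Z) * gbinom (l%:R : F) k%:Z
       * gbinom (m%:R - k%:R : F) n%:Z
       * gbinom ((2 * k)%:R : F) (k%:Z - 2 * l%:Z + m%:Z)
  = \sum_(0 <= k < l.+1)
     gbinom (l%:R : F) k%:Z * gbinom ((2 * k)%:R : F) n%:Z
       * gbinom (n%:R - l%:R : F) (m%:Z + n%:Z - 3 * k%:Z - l%:Z).
Proof.
rewrite !big_mkord -coef_genfunXY_exp -coef_genfunYX_exp -coef_swapXY.
by rewrite rmorphXn rmorph_genfun /= swapXY_X swapXY_Y.
Qed.
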